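(* Let $(\{v_j\},\{p_j\})$ be a sequential norming pair for $\mathbb{R}$ with $|v_j|\ge 1$ for all $j\in\mathbb{N}$, and suppose that $$p_j\left\lfloor\frac{|v_{j+1}|}{|v_j|}-1\right\rfloor\ge 1\quad\text{for all but finitely many } j.$$ Define $x_1=1$ and $x_j=\lfloor |v_1|\rfloor\lfloor |v_2|\rfloor\cdots\lfloor |v_j|\rfloor$ for $j\ge 2$. Let $(G_v,\sigma_v)$ be the topological group generated by $(\{v_j\},\{p_j\})$, and let $(\mathbb{Z},\sigma_x)$ be the topological group generated by $(\{x_j\},\{p_j\})$ (the subgroup of $\mathbb{R}$ generated by $\{x_j\}$ is $\mathbb{Z}$ since $x_1=1$). Then $(G_v,\sigma_v)$ is locally isometric to $(\mathbb{Z},\sigma_x)$, and the completion $\mathcal{C}(G_v,\sigma_v)$ is locally isometric to the completion $\mathcal{C}(\mathbb{Z},\sigma_x)$.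
   Context: All sequences are indexed by $\mathbb{N}=\{1,2,\dots\}$, and $\lfloor x\rfloor$ is the greatest integer less than or equal to $x$. A sequential norming pair (SNP) for $\mathbb{R}^n$ is a pair $(\{v_j\},\{p_j\})$ where $\{p_j\}$ is a nonincreasing sequence of positive real numbers converging to $0$, and $\{v_j\}$ is a sequence in $\mathbb{R}^n\setminus\{0\}$ such that $\{\|v_j\|\}$ (Euclidean norm) is nondecreasing and $\{p_{j+1}\|v_{j+1}\|/\|v_j\|\}$ has a positive lower bound. The topological group generated by a pair $(\{v_j\},\{p_j\})$ is $(G_v,\sigma_v)$, where $G_v$ is the subgroup of $\mathbb{R}^n$ generated by $\{v_j\}$ and $\sigma_v(x)=\inf\{\sum |c_j|p_j : x=\sum c_jv_j,\ c_j\in\mathbb{Z}\}$ (finite sums). For an SNP, $\sigma_v$ induces the translation-invariant metric $d(x,y)=\sigma_v(x-y)$ and a metrizable group topology on $G_v$ (known). $\mathcal{C}(G_v,\sigma_v)$ is the completion of $G_v$ as a metric space for $d$, with the group operations extended continuously. Two such metric groups are locally isometric if some open neighborhood of the identity in one is isometric (via a distance-preserving bijection) to some open neighborhood of the identity in the other. *)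

(* Defs.v *)
From HB Require Import structures.
From mathcomp Require Import all_boot all_order all_algebra.
From mathcomp Require Import generic_quotient ring_quotient.
From mathcomp Require Import all_classical all_reals.
From mathcomp Require Import interval_inference topology normedtype sequences.
From mathcomp Require Import ring lra.

Set Implicit Arguments.
Unset Strict Implicit.
Unset Printing Implicit Defensive.

Import Order.TTheory GRing.Theory Num.Theory.
Import numFieldNormedType.Exports.

Local Open Scope classical_set_scope.
Local Open Scope ring_scope.
Local Open Scope quotient_scope.

(* A pair (G, sigma): an abelian group with a group norm. The library's norms *)
(* on Z-modules satisfy |x *+ n| = |x| *+ n, which sigma does not.            *)
HB.mixin Record Zmodule_isGroupNormed (R : numDomainType) G
    & GRing.Zmodule G := {
  gnorm : G -> R ;
  gnorm0 : gnorm 0 = 0 ;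
  gnorm_eq0 : forall x, gnorm x = 0 -> x = 0 ;
  gnormN : forall x, gnorm (- x) = gnorm x ;
  gnormD : forall x y, gnorm (x + y) <= gnorm x + gnorm y
}.

#[short(type="gnormedZmodType")]
HB.structure Definition GroupNormed (R : numDomainType) :=
  {G of GRing.Zmodule G & Zmodule_isGroupNormed R G}.

(* The group G with the translation-invariant metric d(x, y) = sigma(x - y).  *)
Definition metr (R : numDomainType) (G : gnormedZmodType R) : Type := G.

Section metr.
Variables (R : realFieldType) (G : gnormedZmodType R).

HB.instance Definition _ := GRing.Zmodule.on (metr G).

Let dist (x y : metr G) : R := gnorm ((x : G) - y).

Let distxx x : dist x x = 0. Proof. by rewrite /dist subrr gnorm0. Qed.

Let dist_positivity x y : dist x y = 0 -> x = y.
Proof. by move/gnorm_eq0/eqP; rewrite subr_eq0 => /eqP. Qed.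

Let dist_sym x y : dist x y = dist y x.
Proof. by rewrite /dist -gnormN opprB. Qed.

Let dist_triangle y x z : dist x z <= dist x y + dist y z.
Proof. by rewrite /dist -[in leLHS](subrKA y) gnormD. Qed.

HB.instance Definition _ := isMetric.Build R (metr G)
  distxx dist_positivity dist_sym dist_triangle.

Lemma mdistE (x y : metr G) : mdist x y = gnorm ((x : G) - y).
Proof. by []. Qed.

Let sub_continuous : continuous (fun x : metr G * metr G => x.1 - x.2).
Proof.
move=> [a b]; apply/metricType_numDomainType.cvgrPdist_lt => e e0 /=.
have e20 : 0 < e / 2 by rewrite divr_gt0.
exists (ball a (e / 2), ball b (e / 2)).
  by split; exact: nbhsx_ballx.
move=> [x y] [/=]; rewrite !ballEmdist /= !mdistE => ax byy.
have -> : (a : G) - b - (x - y) = (a - x) - (b - y).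
  by rewrite !opprD addrACA.
by rewrite (le_lt_trans (gnormD _ _))// gnormN [e]splitr ltrD.
Qed.

HB.instance Definition _ :=
  PreTopologicalNmodule_isTopologicalZmodule.Build (metr G) sub_continuous.

HB.instance Definition _ := isPointed.Build (metr G) 0.

End metr.

Definition locally_isometric (R : realFieldType) (G H : gnormedZmodType R) :=
  exists (U : set (metr G)) (V : set (metr H)),
    [/\ open U, U 0, open V, V 0 &
      exists f : metr G -> metr H, set_bij U V f /\
        forall x y, U x -> U y -> mdist (f x) (f y) = mdist x y].

Section Cauchy_sequences.
Variables (R : realType) (G : gnormedZmodType R).

Lemma gnorm_ge0 (x : G) : 0 <= gnorm x.
Proof. by rewrite -[x]subr0; exact: (@mdist_ge0 R (metr G)). Qed.

Lemma gnormB (x y : G) : gnorm (x - y) <= gnorm x + gnorm y.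
Proof. by rewrite (le_trans (gnormD _ _))// gnormN. Qed.

Lemma gnormBC (x y : G) : gnorm (x - y) = gnorm (y - x).
Proof. by rewrite -gnormN opprB. Qed.

Lemma ler_gnormB (x y : G) : `|gnorm x - gnorm y| <= gnorm (x - y).
Proof.
rewrite ler_norml lerBrDr lerBlDr; apply/andP; split.
  by rewrite addrC lerBlDr gnormBC (le_trans _ (gnormD _ _))// addrC subrK.
by rewrite (le_trans _ (gnormD _ _))// subrK.
Qed.

Definition cauchy_seq : {pred nat -> G} :=
  fun x => `[< cauchy ((x : nat -> metr G) @ \oo) >].

Lemma cauchy_seqP (x : nat -> G) :
  reflect (forall e : R, 0 < e -> exists N, forall m n,
             (N <= m)%N -> (N <= n)%N -> gnorm (x m - x n) < e)
          (x \in cauchy_seq).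
Proof.
apply: (iffP idP) => [/asboolP xc e e0|xc].
  have /cauchy_ballP/(_ _ e0) := xc.
  rewrite near_simpl => -[[A B] /= [[N1 _ N1A] [N2 _ N2B]] AB].
  exists (maxn N1 N2) => m n; rewrite !geq_max => /andP[m1 m2] /andP[n1 n2].
  have /= := AB (m, n); rewrite ballEmdist /= mdistE; apply.
  by split; [exact: N1A|exact: N2B].
apply/asboolP/cauchy_ballP => e e0; have [N xN] := xc _ e0.
rewrite near_simpl; exists ([set m | N <= m]%N, [set m | N <= m]%N).
  by split; exists N.
move=> [m n] [/= Nm Nn].
by rewrite ballEmdist /= mdistE; exact: xN.
Qed.

Lemma cauchy_seq_zmod : zmod_closed cauchy_seq.
Proof.
split=> [|x y /cauchy_seqP xc /cauchy_seqP yc]; apply/cauchy_seqP => e e0.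
  by exists 0 => m n _ _; rewrite subr0 gnorm0.
have e20 : 0 < e / 2 by rewrite divr_gt0.
have [N1 xN] := xc _ e20; have [N2 yN] := yc _ e20.
exists (maxn N1 N2) => m n; rewrite !geq_max => /andP[m1 m2] /andP[n1 n2].
have -> : (x - y) m - (x - y) n = (x m - x n) - (y m - y n).
  by rewrite -![(x - y) _]/(x _ - y _) !opprD addrACA.
by rewrite (le_lt_trans (gnormB _ _))// [e]splitr ltrD ?xN ?yN.
Qed.

HB.instance Definition _ :=
  GRing.isZmodClosed.Build (nat -> G) cauchy_seq cauchy_seq_zmod.

Record cauchySeq := CauchySeq {
  cauchySeq_val :> nat -> G ;
  _ : cauchySeq_val \in cauchy_seq }.

HB.instance Definition _ := [isSub for cauchySeq_val].
HB.instance Definition _ := [Choice of cauchySeq by <:].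
HB.instance Definition _ := [SubChoice_isSubZmodule of cauchySeq by <:].

Definition null_seq : {pred cauchySeq} :=
  fun x => `[< (x : nat -> metr G) @ \oo --> (0 : metr G) >].

Definition seq_gnorm (x : cauchySeq) : R := limn (fun n => gnorm (x n)).

Lemma seq_gnorm_cvg (x : cauchySeq) :
  (fun n => gnorm (x n)) @ \oo --> seq_gnorm x.
Proof.
have /cauchy_seqP xc : cauchySeq_val x \in cauchy_seq by case: x.
apply/cauchy_cvgP/cauchy_exP => e e0; have [N xN] := xc _ e0.
exists (gnorm (x N)); exists N => //= m Nm.
by rewrite /ball /= (le_lt_trans (ler_gnormB _ _))// xN.
Qed.

Lemma null_seqP (x : cauchySeq) : (x \in null_seq) = (seq_gnorm x == 0).
Proof.
apply/asboolP/eqP => [x0|x0].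
  apply: (cvg_unique _ (@seq_gnorm_cvg x)) => //.
  apply/cvgrPdist_lt => e e0.
  have /metricType_numDomainType.cvgrPdist_lt/(_ _ e0) := x0.
  apply: filterS => n; rewrite mdistE sub0r gnormN.
  by rewrite sub0r normrN ger0_norm ?gnorm_ge0.
apply/metricType_numDomainType.cvgrPdist_lt => e e0.
have /cvgrPdist_lt/(_ _ e0) := @seq_gnorm_cvg x.
apply: filterS => n; rewrite mdistE sub0r gnormN.
by rewrite x0 sub0r normrN ger0_norm ?gnorm_ge0.
Qed.

Lemma seq_gnorm0 : seq_gnorm 0 = 0.
Proof.
apply: (cvg_unique _ (@seq_gnorm_cvg 0)) => //.
by apply: cvg_near_cst; apply: nearW => n; rewrite -[X in X = _]/(gnorm 0) gnorm0.
Qed.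

Lemma seq_gnormN (x : cauchySeq) : seq_gnorm (- x) = seq_gnorm x.
Proof.
apply: (cvg_unique _ (@seq_gnorm_cvg (- x))) => //.
apply: cvg_trans (@seq_gnorm_cvg x); apply: near_eq_cvg.
by apply: nearW => n; rewrite -[RHS]/(gnorm (- x n)) gnormN.
Qed.

Lemma seq_gnormD (x y : cauchySeq) :
  seq_gnorm (x + y) <= seq_gnorm x + seq_gnorm y.
Proof.
have h := cvgB (cvgD (@seq_gnorm_cvg x) (@seq_gnorm_cvg y))
  (@seq_gnorm_cvg (x + y)).
rewrite -subr_ge0; apply: (cvgr_to_ge (h _ _)); apply: nearW => n.
rewrite -[X in _ <= X]/(gnorm (x n) + gnorm (y n) - gnorm (x n + y n)).
by rewrite subr_ge0 gnormD.
Qed.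

Lemma seq_gnormB (x y : cauchySeq) :
  seq_gnorm (x - y) <= seq_gnorm x + seq_gnorm y.
Proof. by rewrite (le_trans (seq_gnormD _ _))// seq_gnormN. Qed.

Lemma seq_gnorm_ge0 (x : cauchySeq) : 0 <= seq_gnorm x.
Proof.
apply: (cvgr_to_ge (@seq_gnorm_cvg x)); apply: nearW => n; exact: gnorm_ge0.
Qed.

Lemma null_seq_zmod : zmod_closed null_seq.
Proof.
split=> [|x y]; rewrite !null_seqP; first by rewrite seq_gnorm0.
move=> /eqP x0 /eqP y0; rewrite eq_le seq_gnorm_ge0 andbT.
by rewrite (le_trans (seq_gnormB _ _))// x0 y0 addr0.
Qed.

HB.instance Definition _ :=
  GRing.isZmodClosed.Build cauchySeq null_seq null_seq_zmod.

End Cauchy_sequences.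

Arguments cauchy_seq {R} G _.
Arguments null_seq {R} G _.

(* The group operations, and the norm of the completion, are induced by the   *)
(* termwise ones; completion_in is the dense isometric embedding of G.        *)
Definition completion (R : realType) (G : gnormedZmodType R) : Type :=
  {ideal_quot (null_seq G)}.

Section completion.
Variables (R : realType) (G : gnormedZmodType R).

Local Notation Q := {ideal_quot (null_seq G)}.

HB.instance Definition _ := GRing.Zmodule.on (completion G).

Definition completion_gnorm (a : completion G) : R :=
  seq_gnorm (repr (a : Q)).

Lemma completion_gnormE (x : cauchySeq G) :
  completion_gnorm (\pi_Q x) = seq_gnorm x.
Proof.
rewrite /completion_gnorm; set y := repr _.
have /eqP : y = x %[mod Q] by rewrite reprK.
rewrite -Quotient.idealrBE null_seqP => /eqP yx.
apply/eqP; rewrite eq_le; apply/andP; split.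
  by rewrite -[y in leLHS](subrK x) (le_trans (seq_gnormD _ _))// yx add0r.
rewrite -[x in leLHS](subrK y) (le_trans (seq_gnormD _ _))//.
by rewrite -opprB seq_gnormN yx add0r.
Qed.

Let completion_gnorm0 : completion_gnorm 0 = 0.
Proof.
by rewrite -[0]/(0 : Q) -[0]pi_zeror completion_gnormE seq_gnorm0.
Qed.

Let completion_gnorm_eq0 a : completion_gnorm a = 0 -> a = 0.
Proof.
rewrite -[a]/(a : Q) -[a]reprK completion_gnormE => a0.
apply/eqP; rewrite -[0]/(0 : Q) -[0]pi_zeror.
by rewrite -Quotient.idealrBE subr0 null_seqP a0.
Qed.

Let completion_gnormN a : completion_gnorm (- a) = completion_gnorm a.
Proof.
rewrite -[- a]/(- (a : Q)) -[a]/(a : Q).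
by rewrite -[a]reprK -pi_oppr !completion_gnormE seq_gnormN.
Qed.

Let completion_gnormD a b :
  completion_gnorm (a + b) <= completion_gnorm a + completion_gnorm b.
Proof.
rewrite -[a + b]/((a : Q) + (b : Q)).
rewrite -[a]/(a : Q) -[b]/(b : Q).
by rewrite -[a]reprK -[b]reprK -pi_addr !completion_gnormE seq_gnormD.
Qed.

HB.instance Definition _ := Zmodule_isGroupNormed.Build R (completion G)
  completion_gnorm0 completion_gnorm_eq0 completion_gnormN completion_gnormD.

Lemma cst_cauchy (x : G) : (fun _ : nat => x) \in cauchy_seq G.
Proof. by apply/cauchy_seqP => e e0; exists 0 => m n _ _; rewrite subrr gnorm0. Qed.

Definition completion_in (x : G) : completion G :=
  \pi_Q (CauchySeq (cst_cauchy x)).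

Lemma completion_in_zmod : zmod_morphism completion_in.
Proof.
move=> x y; rewrite /completion_in.
rewrite -[RHS]/((\pi_Q (CauchySeq (cst_cauchy x)) -
  \pi_Q (CauchySeq (cst_cauchy y)))).
by rewrite -pi_oppr -pi_addr; congr (\pi _); exact: val_inj.
Qed.

HB.instance Definition _ :=
  GRing.isZmodMorphism.Build G (completion G) completion_in completion_in_zmod.

Lemma gnorm_completion_in (x : G) : gnorm (completion_in x) = gnorm x.
Proof.
rewrite -[LHS]/(completion_gnorm _) completion_gnormE.
apply: (cvg_unique _ (@seq_gnorm_cvg R G (CauchySeq (cst_cauchy x)))) => //.
by apply: cvg_near_cst; exact: nearW.
Qed.

Lemma pi_sub_completion_in (s : cauchySeq G) (e : R) N :
  (forall n, (N <= n)%N -> gnorm (s n - s N) < e) ->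
  gnorm ((\pi_Q s : completion G) - completion_in (s N)) <= e.
Proof.
move=> sN; rewrite -[X in gnorm X]/(\pi_Q s -
  \pi_Q (CauchySeq (cst_cauchy (s N)))).
rewrite -pi_oppr -pi_addr -[X in X <= _]/(completion_gnorm _) completion_gnormE.
apply: (cvgr_to_le (@seq_gnorm_cvg R G _)); exists N => // n /= /sN /ltW.
exact.
Qed.

Lemma completion_approx (a : completion G) (e : R) : 0 < e ->
  exists x, gnorm (a - completion_in x) < e.
Proof.
move=> e0; rewrite -[a]/(a : Q) -[a]reprK.
set s := repr _; have /cauchy_seqP sc : cauchySeq_val s \in cauchy_seq G.
  by case: (s).
have e20 : 0 < e / 2 by rewrite divr_gt0.
have [N sN] := sc _ e20; exists (s N).
rewrite (le_lt_trans (@pi_sub_completion_in s (e / 2) N _))//.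
  by move=> n Nn; rewrite sN.
by rewrite ltr_pdivrMr// ltr_pMr// ltr1n.
Qed.

Lemma dense_completion_in : dense (completion_in @` [set: G] : set (metr (completion G))).
Proof.
move=> O [a Oa] oO.
have /nbhs_ballP[e /= e0 aeO] : nbhs (a : metr (completion G)) O.
  exact: open_nbhs_nbhs.
have [x axe] := @completion_approx a _ e0.
exists (completion_in x); split; last by exists x.
by apply: aeO; rewrite ballEmdist /= mdistE.
Qed.

Let completion_complete (F : set_system (metr (completion G))) :
  ProperFilter F -> cauchy F -> cvg F.
Proof.
move=> FF /cauchyP Fc.
have h n : exists ax : completion G * G,
    F (ball (ax.1 : metr (completion G)) n.+1%:R^-1) /\
    gnorm (ax.1 - completion_in ax.2) < n.+1%:R^-1.
  have n0 : 0 < n.+1%:R^-1 :> R by rewrite invr_gt0.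
  have [a Fa] := Fc _ n0; have [x ax] := completion_approx a n0.
  by exists (a, x).
have [az {}h] := choice h.
pose a n := (az n).1; pose z n := (az n).2.
have azlt n : gnorm (a n - completion_in (z n)) < n.+1%:R^-1 by case: (h n).
have Fa n : F (ball (a n : metr (completion G)) n.+1%:R^-1) by case: (h n).
have zc : z \in cauchy_seq G.
  apply/cauchy_seqP => e e0.
  have e40 : 0 < e / 4 by rewrite divr_gt0.
  have [N _ HN] := near_infty_natSinv_lt (PosNum e40).
  exists N => m n /HN /= me /HN /= ne.
  rewrite -gnorm_completion_in raddfB /=.
  have [c []] := filter_ex (filterI (Fa m) (Fa n)).
  rewrite !ballEmdist /= !mdistE => mc nc.
  have -> : completion_in (z m) - completion_in (z n) =
      ((a m - c) - (a n - c)) - (a m - completion_in (z m)) +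
      (a n - completion_in (z n)).
    have -> : a m - c - (a n - c) = a m - a n by rewrite opprB addrA subrK.
    by rewrite opprB [a m - a n + _]addrC !addrA !subrK.
  apply: (le_lt_trans (gnormD _ _)).
  apply: (le_lt_trans (lerD (gnormB _ _) (lexx _))).
  apply: (le_lt_trans (lerD (lerD (gnormB _ _) (lexx _)) (lexx _))).
  have := ltrD (ltrD (ltrD mc nc) (azlt m)) (azlt n).
  move/lt_le_trans; apply.
  have -> : e = e / 4 + e / 4 + e / 4 + e / 4 by field.
  by rewrite !lerD// ltW.
pose b : completion G := \pi_Q (CauchySeq zc).
have Fb : F --> (b : metr (completion G)).
  apply/metricType_numDomainType.fcvgrPdist_lt => e e0.
  have e40 : 0 < e / 4 by rewrite divr_gt0.
  have [N1 _ HN1] := near_infty_natSinv_lt (PosNum e40).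
  have [N2 HN2] := cauchy_seqP _ zc _ e40.
  pose N := maxn N1 N2.
  have bz : gnorm (b - completion_in (z N)) <= e / 4.
    apply: (@pi_sub_completion_in (CauchySeq zc)) => n Nn.
    by apply: HN2; rewrite ?(leq_trans _ Nn)// leq_maxr.
  have /= Ne : N.+1%:R^-1 < e / 4 := HN1 N (leq_maxl _ _).
  apply: filterS (Fa N) => c; rewrite ballEmdist /= !mdistE => ac.
  have -> : (b : completion G) - c = (b - completion_in (z N)) -
    (a N - completion_in (z N)) + (a N - c).
    by rewrite opprB !addrA !subrK.
  apply: (le_lt_trans (gnormD _ _)).
  apply: (le_lt_trans (lerD (gnormB _ _) (lexx _))).
  have h1 := ltrD (azlt N) ac.
  apply: (le_lt_trans (y := e / 4 + (N.+1%:R^-1 + N.+1%:R^-1))).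
    by rewrite -addrA lerD// ltW.
  by clear -Ne e0; move: (N.+1%:R^-1) Ne => r; lra.
by apply/cvg_ex; exists b.
Qed.

HB.instance Definition _ :=
  Uniform_isComplete.Build (metr (completion G)) completion_complete.

End completion.

(* Sequences start at index 0, so v j and p j stand for v_(j+1) and p_(j+1). *)
Definition snp (R : realType) (v p : nat -> R) : Prop :=
  [/\ forall j, 0 < p j,
      nonincreasing_seq p &
      p @ \oo --> (0 : R)] /\
  [/\ forall j, v j != 0,
      nondecreasing_seq (fun j => `|v j|) &
      exists2 c : R, 0 < c & forall j, c <= p j.+1 * `|v j.+1| / `|v j|].

Section generated_group.
Variable R : realType.
Implicit Types (v p : nat -> R) (x y : R).

Definition gen_subgroup v : set R :=
  smallest [set H | H 0 /\ forall x y, H x -> H y -> H (x - y)] (range v).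

Definition sigma v p x : R :=
  inf [set s | exists (N : nat) (c : nat -> int),
         x = \sum_(j < N) v j *~ c j /\
         s = \sum_(j < N) `|c j|%:~R * p j].

Definition in_gen_subgroup v : {pred R} := fun x => `[< gen_subgroup v x >].

Lemma in_gen_subgroup_zmod v : zmod_closed (in_gen_subgroup v).
Proof.
split=> [|x y /asboolP xv /asboolP yv]; apply/asboolP => H HH; have [[H0 HB] _] := HH.
  exact: H0.
by apply: HB; [exact: xv H HH|exact: yv H HH].
Qed.

HB.instance Definition _ v :=
  GRing.isZmodClosed.Build R (in_gen_subgroup v) (in_gen_subgroup_zmod v).

Lemma gen_subgroupP v x : gen_subgroup v x <->
  exists (N : nat) (c : nat -> int), x = \sum_(j < N) v j *~ c j.
Proof.
split=> [xv|[N [c ->]]].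
  pose H := [set x | exists (N : nat) (c : nat -> int), x = \sum_(j < N) v j *~ c j].
  suff : gen_subgroup v `<=` H by exact.
  apply: smallest_sub => /=.
    split; first by exists 0, (fun=> 0); rewrite big_ord0.
    move=> _ _ [N [c ->]] [M [d ->]].
    exists (maxn N M), (fun j => (if (j < N)%N then c j else 0) -
                                 (if (j < M)%N then d j else 0)).
    under [RHS]eq_bigr do rewrite mulrzBr.
    rewrite big_split /= sumrN; congr (_ - _).
      rewrite (big_ord_widen (maxn N M) (fun j => v j *~ c j)) ?leq_maxl//.
      by rewrite big_mkcond; apply: eq_bigr => j _; case: ifP.
    rewrite (big_ord_widen (maxn N M) (fun j => v j *~ d j)) ?leq_maxr//.
    by rewrite big_mkcond; apply: eq_bigr => j _; case: ifP.
  move=> _ [j _ <-]; exists j.+1, (fun i => (i == j)%:Z).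
  rewrite big_ord_recr /= eqxx mulr1z big1 ?add0r// => i _.
  by rewrite (ltn_eqF (ltn_ord i)).
apply/asboolP; rewrite -[X in is_true X]/(_ \in in_gen_subgroup v).
apply: rpred_sum => j _; apply: rpredMz; apply/asboolP => H [_]; apply.
by exists j.
Qed.

End generated_group.

(* The carrier is G_v; the proof of snp v p makes sigma v p a group norm. *)
Record genGroup (R : realType) (v p : nat -> R) (vp : snp v p) := GenGroup {
  genGroup_val :> R ;
  _ : genGroup_val \in in_gen_subgroup v }.

Section genGroup.
Variables (R : realType) (v p : nat -> R) (vp : snp v p).

HB.instance Definition _ := [isSub for @genGroup_val R v p vp].
HB.instance Definition _ := [Choice of genGroup vp by <:].
HB.instance Definition _ := [SubChoice_isSubZmodule of genGroup vp by <:].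

Let p_gt0 j : 0 < p j. Proof. by case: vp => -[]. Qed.

Let cost N (c : nat -> int) := \sum_(j < N) `|c j|%:~R * p j.

Let costs (x : R) := [set s | exists (N : nat) (c : nat -> int),
         x = \sum_(j < N) v j *~ c j /\ s = cost N c].

Let cost_ge0 N c : 0 <= cost N c.
Proof. by apply: sumr_ge0 => j _; rewrite mulr_ge0 ?ler0z// ltW. Qed.

Let costs_lb x : lbound (costs x) 0.
Proof. by move=> _ [N [c [_ ->]]]; exact: cost_ge0. Qed.

Let costs_hasinf (x : genGroup vp) : has_inf (costs x).
Proof.
split; last by exists 0; exact: costs_lb.
case: x => x /= /asboolP/gen_subgroupP[N [c xc]].
by exists (cost N c), N, c.
Qed.

Let sigma_le N (c : nat -> int) : sigma v p (\sum_(j < N) v j *~ c j) <= cost N c.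
Proof. by apply: ge_inf; [exists 0; exact: costs_lb|exists N, c]. Qed.

Let sigma_ge0 x : 0 <= sigma v p x.
Proof.
have [x0|/set0P[s sx]] := eqVneq (costs x) set0.
  by rewrite /sigma -/(costs x) x0 inf0.
by apply: lb_le_inf; [exists s|exact: costs_lb].
Qed.

Let sigma0 : sigma v p 0 = 0.
Proof.
apply/eqP; rewrite eq_le sigma_ge0 andbT.
by have := sigma_le 0 (fun=> 0); rewrite /cost !big_ord0.
Qed.

Let sigmaN x : sigma v p (- x) = sigma v p x.
Proof.
have sub y : costs (- y) `<=` costs y.
  move=> _ [N [c [yc ->]]]; exists N, (fun j => - c j); split.
    by rewrite -[y]opprK yc -sumrN; apply: eq_bigr => j _; rewrite mulrNz.
  by apply: eq_bigr => j _; rewrite normrN.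
rewrite /sigma -/(costs _) -/(costs _); congr inf.
by apply/seteqP; split; [exact: sub|rewrite -{1}[x]opprK; exact: sub].
Qed.

Let sigmaD (x y : genGroup vp) :
  sigma v p ((x : R) + (y : R)) <= sigma v p x + sigma v p y.
Proof.
apply/ler_addgt0Pr => e e0; have e20 : 0 < e / 2 by rewrite divr_gt0.
have [_ [N [c [xc ->]]] xe] := inf_adherent e20 (costs_hasinf x).
have [_ [M [d [yd ->]]] ye] := inf_adherent e20 (costs_hasinf y).
pose b (j : nat) : int := (if (j < N)%N then c j else 0) + (if (j < M)%N then d j else 0).
have -> : (x : R) + (y : R) = \sum_(j < maxn N M) v j *~ b j.
  under eq_bigr do rewrite mulrzDr; rewrite big_split /= xc yd; congr (_ + _).
    rewrite (big_ord_widen (maxn N M) (fun j => v j *~ c j)) ?leq_maxl//.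
    by rewrite big_mkcond; apply: eq_bigr => j _; case: ifP.
  rewrite (big_ord_widen (maxn N M) (fun j => v j *~ d j)) ?leq_maxr//.
  by rewrite big_mkcond; apply: eq_bigr => j _; case: ifP.
apply: le_trans (sigma_le _ _) _.
have : cost (maxn N M) b <= cost N c + cost M d.
  rewrite {2}/cost (big_ord_widen (maxn N M) (fun j => `|c j|%:~R * p j)) ?leq_maxl//.
  rewrite {2}/cost (big_ord_widen (maxn N M) (fun j => `|d j|%:~R * p j)) ?leq_maxr//.
  rewrite [in leRHS]big_mkcond [X in _ <= _ + X]big_mkcond -big_split /=.
  apply: ler_sum => j _.
  apply: (@le_trans _ _ ((`|if (j < N)%N then c j else 0| +
                          `|if (j < M)%N then d j else 0|)%:~R * p j)).
    by rewrite ler_wpM2r ?(ltW (p_gt0 _))// ler_int ler_normD.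
  by rewrite intrD mulrDl; case: ifP; case: ifP; rewrite ?normr0 ?mul0r.
rewrite /sigma -/(costs _) -/(costs _).
by move: xe ye; rewrite -/(sigma v p x) -/(sigma v p y); lra.
Qed.

Let sigma_small (dl e x : R) N (c : nat -> int) :
  (forall j, dl * `|v j| <= p j.+1 * `|v j.+1|) -> 0 < dl ->
  e <= p 0 -> e <= dl / 2 -> x != 0 ->
  x = \sum_(j < N) v j *~ c j -> cost N c < e -> dl * `|v 0| <= 2 * e * `|x|.
Proof.
move=> hdl dl0 ep0 edl x0.
elim: N => [|m IH] xc ce; first by rewrite xc big_ord0 eqxx in x0.
have [cm0|cm0] := eqVneq (c m) 0.
  move: xc ce; rewrite /cost !big_ord_recr /= cm0 mulr0z normr0 mul0r !addr0.
  exact: IH.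
have pc : p m <= `|c m|%:~R * p m.
  rewrite ler_peMl ?(ltW (p_gt0 _))// -[1]/(1%:~R) ler_int.
  by rewrite -gtz0_ge1 normr_gt0.
have costE : cost m.+1 c = cost m c + `|c m|%:~R * p m.
  by rewrite /cost big_ord_recr.
have pme : p m < e by rewrite (le_lt_trans pc)// (le_lt_trans _ ce)// costE lerDr.
case: m => [|m] in IH xc ce cm0 pc costE pme *; first by move: pme ep0; lra.
have nv : nondecreasing_seq (fun j => `|v j|) by case: vp => _ [].
have np : nonincreasing_seq p by case: vp => -[].
have hS : dl * `|\sum_(j < m.+1) v j *~ c j| <= cost m.+1 c * `|v m.+1|.
  rewrite /cost mulr_suml.
  apply: le_trans (_ : dl * (\sum_(j < m.+1) `|v j *~ c j|) <= _).
    by rewrite ler_pM2l// ler_norm_sum.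
  rewrite mulr_sumr; apply: ler_sum => j _.
  rewrite -mulrzl normrM -intr_norm mulrCA -mulrA ler_wpM2l//.
  rewrite (le_trans (hdl j))// ler_pM//; first exact: ltW.
    exact: np.
  by apply: nv; exact: (ltn_ord j).
have hv : `|v m.+1| <= `|v m.+1 *~ c m.+1|.
  rewrite -mulrzl normrM -intr_norm ler_peMl// -[1]/(1%:~R) ler_int.
  by rewrite -gtz0_ge1 normr_gt0.
have hx : `|v m.+1 *~ c m.+1| <= `|x| + `|\sum_(j < m.+1) v j *~ c j|.
  have -> : v m.+1 *~ c m.+1 = x - \sum_(j < m.+1) v j *~ c j.
    by rewrite xc big_ord_recr /= addrAC subrr add0r.
  exact: ler_normB.
have h0 : dl * `|v 0| <= p m.+1 * `|v m.+1|.
  by rewrite (le_trans _ (hdl m))// ler_pM2l//; apply: nv.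
have v0 := normr_ge0 (v m.+1).
have h1 : cost m.+1 c * `|v m.+1| <= dl / 2 * `|v m.+1|.
  rewrite ler_wpM2r// (le_trans _ edl)// ltW// (le_lt_trans _ ce)//.
  by rewrite costE lerDl mulr_ge0 ?ler0z// ltW.
have h2 : `|\sum_(j < m.+1) v j *~ c j| <= `|v m.+1| / 2.
  by rewrite -(ler_pM2l dl0) (le_trans hS)// (le_trans h1)// mulrA mulrAC.
have h3 : `|v m.+1| <= 2 * `|x| by lra.
have e0 : 0 < e := lt_trans (p_gt0 _) pme.
rewrite (le_trans h0)// (le_trans (_ : _ <= e * `|v m.+1|))//.
  by rewrite ler_wpM2r// ltW.
by rewrite [2 * e]mulrC -mulrA ler_pM2l.
Qed.

Let sigma_eq0 (x : genGroup vp) : sigma v p x = 0 -> x = 0.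
Proof.
move=> sx0; apply: val_inj; rewrite raddf0; apply/eqP/negP => /negP x0.
have [_ [vn0 _ [dl dl0 hdl]]] := vp.
have {}hdl j : dl * `|v j| <= p j.+1 * `|v j.+1|.
  by rewrite -ler_pdivlMr ?normr_gt0// hdl.
have xp : 0 < `|val x| by rewrite normr_gt0.
have v0p : 0 < `|v 0| by rewrite normr_gt0.
pose e3 := dl * `|v 0| / (4 * `|val x|).
have e30 : 0 < e3 by rewrite /e3 divr_gt0// mulr_gt0.
pose e := Num.min (p 0) (Num.min (dl / 2) e3).
have e0 : 0 < e by rewrite /e !lt_min p_gt0 e30 divr_gt0.
have [_ [N [c [xc ->]]]] := inf_adherent e0 (costs_hasinf x).
rewrite -/(sigma v p x) sx0 add0r => ce.
have := sigma_small hdl dl0 _ _ x0 xc ce.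
have -> : e <= p 0 by rewrite /e ge_min lexx.
have -> : e <= dl / 2 by rewrite /e !ge_min lexx orbT.
move=> /(_ isT isT).
have : e <= e3 by rewrite /e !ge_min lexx !orbT.
rewrite /e3 ler_pdivlMr ?mulr_gt0// => h1 h2.
have := mulr_gt0 dl0 v0p; lra.
Qed.

Definition genGroup_gnorm (x : genGroup vp) : R := sigma v p (genGroup_val x).

Let gsigma0 : genGroup_gnorm 0 = 0. Proof. exact: sigma0. Qed.

Let gsigma_eq0 x : genGroup_gnorm x = 0 -> x = 0. Proof. exact: sigma_eq0. Qed.

Let gsigmaN x : genGroup_gnorm (- x) = genGroup_gnorm x. Proof. exact: sigmaN. Qed.

Let gsigmaD x y : genGroup_gnorm (x + y) <= genGroup_gnorm x + genGroup_gnorm y.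
Proof. exact: sigmaD. Qed.

HB.instance Definition _ := Zmodule_isGroupNormed.Build R (genGroup vp)
  gsigma0 gsigma_eq0 gsigmaN gsigmaD.

Lemma gnormE (x : genGroup vp) : gnorm x = sigma v p (genGroup_val x).
Proof. by []. Qed.

End genGroup.

(* x_1 = 1, and x_j = floor |v_1| * ... * floor |v_j| for j >= 2, shifted to  *)
(* index 0. In particular floor |v_1| occurs in x_2 but not in x_1.           *)
Definition xseq (R : realType) (v : nat -> R) (j : nat) : R :=
  if j is 0 then 1 else \prod_(i < j.+1) (Num.floor `|v i|)%:~R.

Lemma snp_xseq (R : realType) (v p : nat -> R) :
  snp v p -> (forall j, 1 <= `|v j|) -> snp (xseq v) p.
Proof.
move=> [hp [vn0 nv [c c0 hc]]] v1; split=> //.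
have f1 j : 1 <= (Num.floor `|v j|)%:~R :> R.
  by rewrite -[1]/(1%:~R) ler_int floor_ge_int v1.
have xgt0 j : 0 < xseq v j.
  case: j => [|j] //=; apply: prodr_gt0 => i _; exact: lt_le_trans (f1 _).
have xS j : (Num.floor `|v j.+1|)%:~R * xseq v j <= xseq v j.+1.
  rewrite [xseq v j.+1]/= big_ord_recr /= mulrC ler_wpM2r ?(le_trans _ (f1 _))//.
  by case: j => [|j] //=; rewrite big_ord1.
split=> [j||]; first by rewrite gt_eqF.
  apply/nondecreasing_seqP => j; rewrite !gtr0_norm//.
  by rewrite (le_trans _ (xS _))// ler_peMl// ltW.
exists (c / 2) => [|j]; first by rewrite divr_gt0.
rewrite ler_pdivlMr ?normr_gt0 ?gt_eqF// !gtr0_norm//.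
have p0 : 0 < p j.+1 by case: hp.
apply: le_trans (_ : p j.+1 * ((Num.floor `|v j.+1|)%:~R * xseq v j) <= _);
  last by rewrite ler_pM2l.
rewrite mulrA ler_pM2r//.
have := hc j; rewrite ler_pdivlMr ?normr_gt0// => hcj.
have : c <= p j.+1 * `|v j.+1| by rewrite (le_trans _ hcj)// ler_peMr// ltW.
have hf : `|v j.+1| <= 2 * (Num.floor `|v j.+1|)%:~R.
  have := floorD1_gt (`|v j.+1|); rewrite intrD; have := f1 j.+1; lra.
have := ler_pM2l p0 `|v j.+1| (2 * (Num.floor `|v j.+1|)%:~R); rewrite hf.
move=> h1 h2; rewrite ler_pdivrMr// (le_trans h2)//.
by rewrite -mulrA [_ * 2]mulrC h1.
Qed.

(* The subgroup of R generated by xseq v is Z. *)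
Lemma gen_subgroup_xseq (R : realType) (v : nat -> R) :
  gen_subgroup (xseq v) = range (fun z : int => z%:~R).
Proof.
apply/seteqP; split=> [x|_ [z _ <-]].
  apply: smallest_sub; first split=> /=; first by exists 0.
    by move=> _ _ [a _ <-] [b _ <-]; exists (a - b) => //; rewrite intrB.
  move=> _ [[|j] _ <-]; first by exists 1.
  exists (\prod_(i < j.+2) Num.floor `|v i|) => //.
  by rewrite rmorph_prod.
by apply/gen_subgroupP; exists 1%N, (fun=> z); rewrite big_ord1.
Qed.

(* Main.v *)
(* The free abelian group F on generators e_j, with the weighted norm         *)
(* |sum c_j e_j| = sum |c_j| p_j, maps onto G_v by e_j |-> v_j. This          *)
(* homomorphism is injective, hence isometric, near 0: |c_j| p_j < 1 and the  *)
(* growth of v give |c_j v_j| <= |v_(j+1)| - |v_j|, so that by telescoping    *)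
(* sum c_j v_j = 0 is impossible unless c = 0. Since                          *)
(* x_(j+1)/x_j = floor |v_(j+1)| for j >= 2, the sequence x grows as fast as  *)
(* needed, so F also covers (Z, sigma_x) near 0. Two covers by F compose to a *)
(* local isometry of their targets, and covers pass to completions.           *)
From HB Require Import structures.
From mathcomp Require Import all_boot all_order all_algebra.
From mathcomp Require Import generic_quotient ring_quotient.
From mathcomp Require Import all_classical all_reals.
From mathcomp Require Import topology normedtype sequences.
Require Import Defs.

Set Implicit Arguments.
Unset Strict Implicit.
Unset Printing Implicit Defensive.

Import Order.TTheory GRing.Theory Num.Theory.
Import numFieldNormedType.Exports.

Local Open Scope classical_set_scope.
Local Open Scope ring_scope.

(** By [sigmaE], [sigma v p] and [sigma (xseq v) p] are quotient norms of the same weighted norm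
    [wnorm p]; only the evaluation map [lincomb] differs. By [lincomb_inj0] two cheap
    representations of one element coincide, so a cheap representation attains the infimum, and near
    0 each group is a copy of the same weighted group ([genGroup_local_cover]).
    [local_cover_isometric] composes one cover with a local inverse of the other;
    [local_cover_completion] makes this work for completions too. *)

Definition local_cover (R : realType) (F G : gnormedZmodType R) (h : F -> G)
    (d : R) :=
  [/\ 0 < d, zmod_morphism h, forall c, gnorm c < d -> gnorm (h c) = gnorm c &
      forall x, gnorm x < d -> exists2 c, gnorm c < d & h c = x].

(** * Local isometries from two covers by one group *)

Lemma open_gnorm_lt (R : realType) (G : gnormedZmodType R) (r : R) :
  open ([set x | gnorm x < r] : set (metr G)).
Proof.
rewrite openE => x /= xr; apply/nbhs_ballP; exists (r - gnorm x) => /=.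
  by rewrite subr_gt0.
move=> y; rewrite ballEmdist /= mdistE => xy.
rewrite -[y](subKr x) (le_lt_trans (gnormB _ _))//.
by rewrite addrC -ltrBrDr.
Qed.

(** The isometry is [h] after a local section of [g]. Differences of two elements of norm below [m]
    must stay where both covers preserve norms, so [m] is half the smaller radius. *)
Lemma local_cover_isometric (R : realType) (F G H : gnormedZmodType R)
    (g : F -> G) (h : F -> H) (d e : R) :
  local_cover g d -> local_cover h e -> locally_isometric G H.
Proof.
move=> [d0 gB gd gs] [e0 hB he hs].
pose m := Num.min d e / 2.
have m2 : m + m = Num.min d e by rewrite -splitr.
have m0 : 0 < m by rewrite divr_gt0// lt_min d0 e0.
have md c : gnorm c < m + m -> gnorm c < d by rewrite m2 lt_min => /andP[].
have me c : gnorm c < m + m -> gnorm c < e by rewrite m2 lt_min => /andP[].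
have mlt c : c < m -> c < m + m by move=> cm; rewrite (lt_trans cm)// ltrDl.
have mB (K : gnormedZmodType R) (a b : K) :
    gnorm a < m -> gnorm b < m -> gnorm (a - b) < m + m.
  by move=> am bm; rewrite (le_lt_trans (gnormB _ _))// ltrD.
have /choice[s sP] (x : G) : exists c, gnorm x < m ->
    gnorm c = gnorm x /\ g c = x.
  have [xm|xm] := boolP (gnorm x < m); last by exists 0.
  have xd : gnorm x < d.
    by rewrite (lt_le_trans (mlt _ xm))// m2 ge_min lexx.
  by have [c cd <-] := gs _ xd; exists c; rewrite gd.
(* [s (g c) - c] is killed by [g] and lies where [g] preserves norms, so its norm is 0. *)
have s_inv c : gnorm c < m -> s (g c) = c.
  move=> cm; have gc : gnorm (g c) = gnorm c by apply: gd; apply/md/mlt.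
  have [sc gsc] : gnorm (s (g c)) = gnorm (g c) /\ g (s (g c)) = g c.
    by apply: sP; rewrite gc.
  apply/eqP; rewrite -subr_eq0; apply/eqP/(@gnorm_eq0 R).
  rewrite -gd; last by apply/md/mB => //; rewrite sc gc.
  by rewrite gB gsc subrr gnorm0.
have isom x y : gnorm x < m -> gnorm y < m ->
    gnorm (h (s x) - h (s y)) = gnorm (x - y).
  move=> xm ym; have [sx gx] := sP _ xm; have [sy gy] := sP _ ym.
  have sxy : gnorm (s x - s y) < m + m by rewrite mB ?sx ?sy.
  by rewrite -hB he ?me// -gd ?md// gB gx gy.
exists [set x | gnorm x < m], [set x | gnorm x < m]; split.
- exact: open_gnorm_lt.
- by rewrite /= gnorm0.
- exact: open_gnorm_lt.
- by rewrite /= gnorm0.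
exists (h \o s); split=> [|x y xm ym]; last by rewrite !mdistE /= isom.
split=> [x /= xm|x y|y /= ym].
- by have [sx gx] := sP _ xm; rewrite he ?sx//; apply/me/mlt.
- rewrite !inE /= => xm ym hxy.
  apply/eqP; rewrite -subr_eq0; apply/eqP/(@gnorm_eq0 R).
  by rewrite -isom// hxy subrr gnorm0.
have [|c ce hc] := hs y.
  by rewrite (lt_le_trans (mlt _ ym))// m2 ge_min lexx orbT.
have cm : gnorm c < m by rewrite -he// hc.
exists (g c) => /=; last by rewrite s_inv.
by rewrite gd//; apply/md/mlt.
Qed.

(** * Covers of completions *)

Lemma cauchySeq_valP (R : realType) (G : gnormedZmodType R)
    (s : cauchySeq G) :
  cauchySeq_val s \in cauchy_seq G.
Proof. by case: s. Qed.

Local Notation limit_of := \pi_{ideal_quot (null_seq _)}%qT.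

Lemma completion_eqP (R : realType) (G : gnormedZmodType R)
    (s t : cauchySeq G) :
  limit_of s = limit_of t <-> seq_gnorm (s - t) = 0.
Proof.
have E : (seq_gnorm (s - t) == 0) = (limit_of s == limit_of t).
  by rewrite -null_seqP Quotient.idealrBE.
by split=> /eqP; [rewrite -E|rewrite E] => /eqP.
Qed.

Section completion_cover.
Variables (R : realType) (F G : gnormedZmodType R) (h : F -> G) (d : R).
Hypothesis hd : local_cover h d.

Let d0 : 0 < d. Proof. by case: hd. Qed.
Let hB : zmod_morphism h. Proof. by case: hd. Qed.
Let hn c : gnorm c < d -> gnorm (h c) = gnorm c.
Proof. by case: hd => _ _ + _; exact. Qed.

(** [h] is controlled only near 0, but that is where late differences of a Cauchy sequence lie. *)
Lemma local_cover_cauchy (s : nat -> F) :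
  s \in cauchy_seq F -> h \o s \in cauchy_seq G.
Proof.
move=> /cauchy_seqP sc; apply/cauchy_seqP => e e0.
have [|N sN] := sc (Num.min d e); first by rewrite lt_min d0.
exists N => m n Nm Nn /=; have := sN _ _ Nm Nn; rewrite lt_min => /andP[sd se].
by rewrite -hB hn.
Qed.

Definition cauchy_map (s : cauchySeq F) : cauchySeq G :=
  CauchySeq (local_cover_cauchy (cauchySeq_valP s)).

Lemma cauchy_map_gnorm s : seq_gnorm s < d ->
  seq_gnorm (cauchy_map s) = seq_gnorm s.
Proof.
move=> sd; apply: (cvg_unique _ (@seq_gnorm_cvg R G (cauchy_map s))) => //.
apply: cvg_trans (@seq_gnorm_cvg R F s); apply: near_eq_cvg.
have := @seq_gnorm_cvg R F s => /cvgr_lt/(_ _ sd).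
by apply: filterS => n snd /=; rewrite hn.
Qed.

Lemma cauchy_mapB s t : cauchy_map (s - t) = cauchy_map s - cauchy_map t.
Proof. by apply: val_inj; apply/funext => n /=; exact: hB. Qed.

Definition completion_map (a : completion F) : completion G :=
  limit_of (cauchy_map (repr (a : {ideal_quot (null_seq F)}))).

(** Independence of the representative: two representatives differ by a null sequence, whose image
    is null because [0 < d]. *)
Lemma completion_map_pi (s : cauchySeq F) :
  completion_map (limit_of s) = limit_of (cauchy_map s).
Proof.
apply/completion_eqP; rewrite -cauchy_mapB.
suff st0 : seq_gnorm (repr (limit_of s) - s) = 0.
  by rewrite cauchy_map_gnorm st0.
by apply/completion_eqP; rewrite reprK.
Qed.

(* The radius is halved so that differences of lifts still lie in the ball    *)
(* where h is isometric, which makes a sequence of lifts Cauchy.              *)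
Lemma local_cover_completion : local_cover completion_map (d / 2).
Proof.
have d20 : 0 < d / 2 by rewrite divr_gt0.
have d2d : d / 2 < d by rewrite ltr_pdivrMr// ltr_pMr// ltr1n.
split=> // [a b|a|a].
- rewrite -[a]reprK -[b]reprK.
  rewrite -[X in completion_map X]/(limit_of _ - limit_of _).
  rewrite -pi_oppr -pi_addr !completion_map_pi cauchy_mapB.
  by rewrite -[RHS]/(limit_of _ - limit_of _) -pi_oppr -pi_addr.
- rewrite -[a]reprK completion_map_pi.
  rewrite -[X in X < _]/(completion_gnorm _) -[LHS]/(completion_gnorm _).
  rewrite -[RHS]/(completion_gnorm _) !completion_gnormE => ad.
  by rewrite cauchy_map_gnorm// (lt_trans ad).
rewrite -[a]reprK; set s := repr _.
rewrite -[X in X < _]/(completion_gnorm _) completion_gnormE => sd.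
have [N _ sN] := cvgr_lt _ (@seq_gnorm_cvg R G s) _ sd.
(* Lifts are available once the terms have norm below [d / 2]; the value 0 before [N] does not
   affect the limit. *)
have /choice[c cP] n : exists c, (N <= n)%N ->
    gnorm c < d / 2 /\ h c = s n.
  have [Nn|] := leqP N n; last by exists 0.
  have [_ _ _ hs] := hd.
  have sn2 : gnorm (s n) < d / 2 by exact: sN.
  have [c cd hc] := hs _ (lt_trans sn2 d2d).
  by exists c => _; rewrite -hn// hc.
have cc : c \in cauchy_seq F.
  apply/cauchy_seqP => e e0.
  have [M sM] := cauchy_seqP _ (cauchySeq_valP s) _ e0.
  exists (maxn N M) => m n; rewrite !geq_max => /andP[Nm Mm] /andP[Nn Mn].
  have [cm hcm] := cP _ Nm; have [cn hcn] := cP _ Nn.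
  rewrite -hn ?hB ?hcm ?hcn ?sM//.
  by rewrite (le_lt_trans (gnormB _ _))// [d]splitr ltrD.
pose t := CauchySeq cc.
have ts : seq_gnorm (cauchy_map t - s) = 0.
  apply: (cvg_unique _ (@seq_gnorm_cvg R G (cauchy_map t - s))) => //.
  apply: cvg_near_cst; exists N => // n /= Nn.
  have [_ hcn] := cP _ Nn.
  by rewrite -[X in gnorm X]/(h (c n) - s n) hcn subrr gnorm0.
have tE : seq_gnorm t = seq_gnorm s.
  apply: (cvg_unique _ (@seq_gnorm_cvg R F t)) => //.
  apply: cvg_trans (@seq_gnorm_cvg R G s); apply: near_eq_cvg.
  exists N => // n /= Nn; have [cn hcn] := cP _ Nn.
  by rewrite -hcn hn// (lt_trans cn).
exists (limit_of t).
  by rewrite -[X in X < _]/(completion_gnorm _) completion_gnormE tE.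
by rewrite completion_map_pi; exact/completion_eqP.
Qed.

End completion_cover.

(** * The weighted group of finitely supported sequences *)

(** Padding with zero coefficients lets sums over sequences of different sizes be compared
    termwise. *)
Lemma sum_coef_widen (A : nzSemiRingType) (V : nmodType) (f : nat -> A -> V)
    (c : {poly A}) N : (forall j, f j 0 = 0) -> (size c <= N)%N ->
  \sum_(j < size c) f j c`_j = \sum_(j < N) f j c`_j.
Proof.
move=> f0 cN; rewrite (big_ord_widen N (fun j => f j c`_j))// big_mkcond.
by apply: eq_bigr => j _; case: ltnP => // cj; rewrite nth_default.
Qed.

Definition wnorm (R : realType) (p : nat -> R) (c : {poly int}) : R :=
  \sum_(j < size c) `|c`_j|%:~R * p j.

Definition lincomb (R : realType) (v : nat -> R) (c : {poly int}) : R :=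
  \sum_(j < size c) v j *~ c`_j.

Lemma wnormE (R : realType) (p : nat -> R) (c : {poly int}) N :
  (size c <= N)%N -> wnorm p c = \sum_(j < N) `|c`_j|%:~R * p j.
Proof.
apply: (@sum_coef_widen _ _ (fun j a => `|a|%:~R * p j)) => j.
by rewrite normr0 mul0r.
Qed.

Lemma lincombE (R : realType) (v : nat -> R) (c : {poly int}) N :
  (size c <= N)%N -> lincomb v c = \sum_(j < N) v j *~ c`_j.
Proof. exact: (@sum_coef_widen _ _ (fun j a => v j *~ a)). Qed.

Lemma lincombB (R : realType) (v : nat -> R) : zmod_morphism (lincomb v).
Proof.
move=> c d; pose N := maxn (size c) (size d).
rewrite !(@lincombE _ _ _ N) ?leq_maxl ?leq_maxr ?size_polyB//.
  by rewrite -sumrB; apply: eq_bigr => j _; rewrite coefB mulrzBr.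
by rewrite (leq_trans (size_polyD _ _))// size_polyN.
Qed.

(* {poly int} encodes the finitely supported integer sequences.               *)
Definition wpoly (R : realType) (p : nat -> R) (p_gt0 : forall j, 0 < p j) :
  Type := {poly int}.

Section wpoly.
Variables (R : realType) (p : nat -> R) (p_gt0 : forall j, 0 < p j).

HB.instance Definition _ := GRing.Zmodule.on (wpoly p_gt0).

Lemma wnorm_coef (c : {poly int}) j : `|c`_j|%:~R * p j <= wnorm p c.
Proof.
rewrite (@wnormE _ _ _ (maxn (size c) j.+1)) ?leq_maxl//.
have jN : (j < maxn (size c) j.+1)%N by rewrite leq_maxr.
rewrite (bigD1 (Ordinal jN))//= lerDl sumr_ge0// => i _.
by rewrite mulr_ge0 ?ler0z// ltW.
Qed.

Let wnorm0 : wnorm p 0 = 0.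
Proof. by rewrite /wnorm size_poly0 big_ord0. Qed.

Let wnorm_eq0 c : wnorm p c = 0 -> c = 0.
Proof.
move=> c0; apply/polyP => j; rewrite coef0; apply/eqP; rewrite -normr_le0.
have := wnorm_coef c j; rewrite c0.
by rewrite pmulr_lle0// lerz0.
Qed.

Let wnormN c : wnorm p (- c) = wnorm p c.
Proof.
by rewrite /wnorm size_polyN; apply: eq_bigr => j _; rewrite coefN normrN.
Qed.

Let wnormD c d : wnorm p (c + d) <= wnorm p c + wnorm p d.
Proof.
pose N := maxn (size c) (size d).
rewrite !(@wnormE _ _ _ N) ?leq_maxl ?leq_maxr ?size_polyD//.
rewrite -big_split ler_sum// => j _ /=.
by rewrite -mulrDl ler_wpM2r ?(ltW (p_gt0 j))// -intrD ler_int coefD ler_normD.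
Qed.

HB.instance Definition _ := Zmodule_isGroupNormed.Build R (wpoly p_gt0)
  wnorm0 wnorm_eq0 wnormN wnormD.

End wpoly.

(* The terms below the top index M add up to at most |v_M| - |v_0|, which     *)
(* cannot cancel c_M v_M.                                                     *)
Lemma lincomb_inj0 (R : realType) (v p : nat -> R) (J : nat) (c : {poly int}) :
  snp v p ->
  (forall j, (J <= j)%N -> `|v j| <= p j * (`|v j.+1| - `|v j|)) ->
  wnorm p c < p J -> wnorm p c < 1 -> lincomb v c = 0 -> c = 0.
Proof.
move=> [[p_gt0 pn _] [v0 vn _]] vJ cJ c1 hc.
apply/eqP/negPn/negP => cn0.
have cj j : `|v j *~ c`_j| <= `|v j.+1| - `|v j|.
  rewrite -mulrzl normrM -intr_norm.
  have d0 : 0 <= `|v j.+1| - `|v j| by rewrite subr_ge0 vn.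
  have [Jj|jJ] := leqP J j.
    apply: (@le_trans _ _ (`|c`_j|%:~R * p j * (`|v j.+1| - `|v j|))).
      by rewrite -mulrA ler_wpM2l ?ler0z// vJ.
    by rewrite ler_piMl// (le_trans (wnorm_coef p_gt0 _ _))// ltW.
  (* No growth is assumed below [J], but there a nonzero coefficient would already cost [p j], which
     is at least [p J]. *)
  suff -> : c`_j = 0 by rewrite normr0 mul0r.
  apply/eqP/negPn/negP => cj0.
  have : p J < p J; last by rewrite ltxx.
  rewrite (le_lt_trans _ cJ)// (le_trans (pn _ _ (ltnW jJ)))//.
  rewrite (le_trans _ (wnorm_coef p_gt0 c j))// ler_peMl ?(ltW (p_gt0 j))//.
  by rewrite ler1z -gtz0_ge1 normr_gt0.
have [M sM] : exists M, size c = M.+1.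
  by exists (size c).-1; rewrite prednK// lt0n size_poly_eq0.
have := hc; rewrite /lincomb sM big_ord_recr /=.
move/eqP; rewrite addrC addr_eq0 => /eqP/(congr1 Num.norm); rewrite normrN.
apply/eqP; rewrite gt_eqF//.
have lcM : `|v M| <= `|v M *~ c`_M|.
  rewrite -mulrzl normrM -intr_norm ler_peMl// ler1z -gtz0_ge1 normr_gt0.
  by rewrite -[M]/(M.+1.-1) -sM lead_coef_eq0.
apply: lt_le_trans lcM; apply: le_lt_trans (ler_norm_sum _ _ _) _.
apply: (@le_lt_trans _ _ (\sum_(0 <= j < M) (`|v j.+1| - `|v j|))).
  by rewrite big_mkord ler_sum.
(* The inequality is strict because [v 0] is nonzero. *)
by rewrite telescope_sumr// ltrBlDr ltrDl normr_gt0.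
Qed.

(** * The weighted group covers a generated group *)

Lemma lincomb_poly (R : realType) (v : nat -> R) N (c : nat -> int) :
  lincomb v (\poly_(j < N) c j) = \sum_(j < N) v j *~ c j.
Proof.
rewrite (lincombE _ (size_poly N c)).
by apply: eq_bigr => j _; rewrite coef_poly ltn_ord.
Qed.

Lemma wnorm_poly (R : realType) (p : nat -> R) N (c : nat -> int) :
  wnorm p (\poly_(j < N) c j) = \sum_(j < N) `|c j|%:~R * p j.
Proof.
rewrite (wnormE _ (size_poly N c)).
by apply: eq_bigr => j _; rewrite coef_poly ltn_ord.
Qed.

Lemma sigmaE (R : realType) (v p : nat -> R) x : sigma v p x =
  inf [set s | exists2 c : {poly int}, x = lincomb v c & s = wnorm p c].
Proof.
rewrite /sigma; congr inf; apply/seteqP; split=> s /=.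
  move=> [N [c [-> ->]]]; exists (\poly_(j < N) c j).
    by rewrite lincomb_poly.
  by rewrite wnorm_poly.
by move=> [c -> ->]; exists (size c), (fun j => c`_j).
Qed.

Section genGroup_cover.
Variables (R : realType) (v p : nat -> R) (vp : snp v p).
Variable p_gt0 : forall j, 0 < p j.

Lemma lincomb_in_gen c : lincomb v c \in in_gen_subgroup v.
Proof.
by apply/asboolP/gen_subgroupP; exists (size c), (fun j => c`_j).
Qed.

Definition genGroup_lincomb (c : wpoly p_gt0) : genGroup vp :=
  GenGroup vp (lincomb_in_gen c).

(** The radius is halved so that the difference of two representations of cost below it satisfies
    the bounds of [lincomb_inj0]. *)
Lemma genGroup_local_cover J :
  (forall j, (J <= j)%N -> `|v j| <= p j * (`|v j.+1| - `|v j|)) ->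
  local_cover genGroup_lincomb (Num.min (p J) 1 / 2).
Proof.
move=> vJ; set d := _ / 2.
have dd : d + d = Num.min (p J) 1 by rewrite -splitr.
have lb x : has_lbound
    [set s | exists2 c : {poly int}, x = lincomb v c & s = wnorm p c].
  by exists 0 => _ [c _ ->]; exact: (gnorm_ge0 (c : wpoly p_gt0)).
split.
- by rewrite divr_gt0// lt_min p_gt0 ltr01.
- by move=> a b; apply: val_inj; exact: lincombB.
- move=> c cd; rewrite gnormE sigmaE; apply/eqP; rewrite eq_le.
  apply/andP; split; first by apply: ge_inf => //; exists c.
  apply: lb_le_inf; first by exists (wnorm p c), c.
  (* A representation [b] cheaper than [c] would also cost less than [d], hence equal [c]. *)
  move=> _ [b /= cb ->]; rewrite leNgt; apply/negP => bc.
  suff cb0 : (c : {poly int}) - b = 0 by rewrite -(subr0_eq cb0) ltxx in bc.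
  have : wnorm p ((c : {poly int}) - b) < d + d.
    rewrite (le_lt_trans (@gnormB R (wpoly p_gt0) c b))// ltrD//.
    exact: lt_trans cd.
  rewrite dd lt_min => /andP[cbJ cb1].
  by apply: (lincomb_inj0 vp vJ) => //; rewrite lincombB cb subrr.
move=> x; rewrite gnormE sigmaE => xd; have [|_ [c xc ->] cd] := inf_lt _ xd.
  have /asboolP/gen_subgroupP[N [c xc]] := valP x.
  exists (wnorm p (\poly_(j < N) c j)), (\poly_(j < N) c j) => //.
  by rewrite lincomb_poly.
by exists (c : wpoly p_gt0) => //; apply: val_inj.
Qed.

End genGroup_cover.

Theorem proposition4p2 (R : realType) (v p : nat -> R) (vp : snp v p)
    (v_ge1 : forall j, 1 <= `|v j|)
    (p_floor : \forall j \near \oo,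
       1 <= p j * (Num.floor (`|v j.+1| / `|v j| - 1))%:~R) :
  locally_isometric (genGroup vp) (genGroup (snp_xseq vp v_ge1)) /\
  locally_isometric (completion (genGroup vp))
                    (completion (genGroup (snp_xseq vp v_ge1))).
Proof.
have [J _ pJ] := p_floor.
have p_gt0 j : 0 < p j by case: vp => -[].
have v_gt0 j : 0 < `|v j| by exact: lt_le_trans (v_ge1 j).
have vcover : local_cover (genGroup_lincomb vp (p_gt0 := p_gt0))
    (Num.min (p J) 1 / 2).
  apply: genGroup_local_cover => j /pJ /= pj.
  rewrite -[leLHS]mul1r -ler_pdivlMr// -mulrA mulrBl divff ?gt_eqF//.
  by rewrite (le_trans pj)// ler_pM2l// floor_le.
(* Starting at [J.+1] excludes index 0, where the ratio of consecutive terms of [xseq v] is a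
   product of two floors rather than one. *)
have xcover : local_cover
    (genGroup_lincomb (snp_xseq vp v_ge1) (p_gt0 := p_gt0))
    (Num.min (p J.+1) 1 / 2).
  apply: genGroup_local_cover => -[//|j] Jj.
  have /= pj := pJ _ (ltnW Jj).
  have xS : xseq v j.+2 = xseq v j.+1 * (Num.floor `|v j.+2|)%:~R.
    by rewrite /xseq big_ord_recr.
  have x_gt0 : 0 < xseq v j.+1.
    by apply: prodr_gt0 => i _; rewrite ltr0z gtz0_ge1 floor_ge_int.
  (* Dividing by [|v j.+1|], which is at least 1, does not increase [|v j.+2|]; so the hypothesis on
     [v] bounds the growth of [xseq v] from below. *)
  have floorD1 : Num.floor (`|v j.+2| / `|v j.+1| - 1) + 1 <=
      Num.floor `|v j.+2|.
    rewrite floor_ge_int intrD -lerBrDr (le_trans (floor_le _))// lerB//.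
    by rewrite ler_pdivrMr// ler_peMr.
  have f_ge0 : 0 <= (Num.floor `|v j.+2|)%:~R :> R by rewrite ler0z floor_ge0.
  rewrite -[\prod_(_ < j.+2) _]/(xseq v j.+1).
  rewrite -[\prod_(_ < j.+3) _]/(xseq v j.+2).
  rewrite xS normrM (ger0_norm f_ge0) gtr0_norm//.
  rewrite -{3}[xseq v j.+1]mulr1 -mulrBr mulrCA ler_pMr//.
  rewrite (le_trans pj)// ler_pM2l// lerBrDr.
  by rewrite -[X in _ + X]/(1%:~R) -intrD ler_int.
split; first exact: local_cover_isometric vcover xcover.
exact: local_cover_isometric (local_cover_completion vcover)
  (local_cover_completion xcover).
Qed.
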